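(* Let $\mathbb{K}$ be a field and let $R$ be a $p\times q$ matrix-valued noncommutative rational expression over $\mathbb{K}$ in $z_1,\ldots,z_d$. Let $Z\in\operatorname{dom}_n R$ and $Z'\in\operatorname{dom}_{n'}R$, and let $W=(W_1,\ldots,W_d)\in(\mathbb{K}^{n\times n'})^d$. Then $$\begin{bmatrix} Z & W\\ 0 & Z'\end{bmatrix}:=\left(\begin{bmatrix} Z_1 & W_1\\ 0 & Z_1'\end{bmatrix},\ldots,\begin{bmatrix} Z_d & W_d\\ 0 & Z_d'\end{bmatrix}\right)\in\operatorname{dom}_{n+n'}R$$ and $$P(n+n',p)\,R\left(\begin{bmatrix} Z & W\\ 0 & Z'\end{bmatrix}\right)P(n+n',q)^{\top}=\begin{bmatrix} P(n,p)R(Z)P(n,q)^{\top} & P(n,p)\left(\sum_{j=1}^d\Delta_j(R)(Z,Z')(W_j)\right)P(n',q)^{\top}\\ 0 & P(n',p)R(Z')P(n',q)^{\top}\end{bmatrix}.$$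
   Context: Words. $\mathcal{F}_d$ is the free semigroup (with empty word as neutral element) on letters $g_1,\ldots,g_d$; for $w=g_{i_\ell}\cdots g_{i_1}$ put $z^w=z_{i_\ell}\cdots z_{i_1}$, and similarly $Z^w$ for a $d$-tuple of square matrices. Matrix-valued noncommutative rational expressions in $z_1,\ldots,z_d$. One starts with matrix-valued noncommutative polynomials $P=\sum_{w}P_wz^w$ with $P_w\in\mathbb{K}^{p\times q}$ (finite sum), evaluated on a $d$-tuple $Z$ of $n\times n$ matrices over $\mathbb{K}$ by $P(Z)=\sum_w P_w\otimes Z^w\in\mathbb{K}^{p\times q}\otimes\mathbb{K}^{n\times n}$, and applies successive formal matrix operations: addition, multiplication (of compatible sizes), inversion (of square matrix-valued expressions that are not identically singular on their domain), and forming block matrices (a $p_2\times q_2$ matrix of $p_1\times q_1$ matrix-valued expressions is $p_1p_2\times q_1q_2$ matrix-valued). $\operatorname{dom}R$ is the set of all $d$-tuples $Z$ of square matrices over $\mathbb{K}$ of all sizes such that all the inverses involved in the calculation of $R(Z)$ exist; it is assumed nonempty. $\operatorname{dom}_nR:=\operatorname{dom}R\cap(\mathbb{K}^{n\times n})^d$. The space $\mathbb{K}^{p\times q}\otimes\mathbb{K}^{n\times n}$ is identified with $\mathbb{K}^{pn\times qn}$, viewed as $p\times q$ block matrices with $n\times n$ block entries. Expressions in two tuples of indeterminates. $p\times q$ matrix-valued noncommutative rational expressions in $z_1,\ldots,z_d$ and $z_1',\ldots,z_d'$ are obtained from tensor products $R\otimes R'$ of matrix-valued noncommutative rational expressions $R$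 in $z$ ($p\times q$) and $R'$ in $z'$ ($p'\times q'$), giving a $pp'\times qq'$ matrix-valued expression with $\operatorname{dom}(R\otimes R')=\operatorname{dom}R\times\operatorname{dom}R'$ and $(R\otimes R')(Z,Z')=R(Z)\otimes R'(Z')$, regarded as an element of $\mathbb{K}^{pp'\times qq'}\otimes\mathbb{K}^{n\times n}\otimes\mathbb{K}^{n'\times n'}$ via $\mathbb{K}^{p\times q}\otimes\mathbb{K}^{p'\times q'}\cong\mathbb{K}^{pp'\times qq'}$, by successive sums, products, inversions (of not identically singular square expressions) and forming block matrices, with the obvious domains and evaluations. Difference-differential operators. For $j=1,\ldots,d$ and a $p\times q$ matrix-valued noncommutative rational expression $R$ in $z_1,\ldots,z_d$, the $p\times q$ matrix-valued expression $\Delta_j(R)$ in two tuples of indeterminates is defined recursively by: (1) for a matrix-valued noncommutative polynomial $P=\sum_wP_wz^w$, $\Delta_j(P)=\sum_wP_w\sum_{u,v\colon w=ug_jv}z^u\otimes z'^v$; (2) $\Delta_j(R_1+R_2)=\Delta_j(R_1)+\Delta_j(R_2)$; (3) $\Delta_j(R_1R_2)=\Delta_j(R_1)(1\otimes R_2)+(R_1\otimes1)\Delta_j(R_2)$; (4) $\Delta_j(R^{-1})=-(R^{-1}\otimes1)\Delta_j(R)(1\otimes R^{-1})$; (5) for $R=[R_{ab}]$ a block matrix of expressions, $\Delta_j(R)=[\Delta_j(R_{ab})]$. (In $1\otimes R$ the expression $R$ is taken in the indeterminates $z'$, in $R\otimes 1$ in the indeterminates $z$.) One has $\operatorname{dom}\Delta_j(R)=\operatorname{dom}R\times\operatorname{dom}R$.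 Values as linear mappings. $\mathbb{K}^{n\times n}\otimes\mathbb{K}^{n'\times n'}$ is identified with the space of linear maps $\mathbb{K}^{n\times n'}\to\mathbb{K}^{n\times n'}$, $\sum_iA_i\otimes B_i$ corresponding to $H\mapsto\sum_iA_iHB_i$. Entrywise, $\mathbb{K}^{p\times q}\otimes\mathbb{K}^{n\times n}\otimes\mathbb{K}^{n'\times n'}\cong(\mathbb{K}^{n\times n}\otimes\mathbb{K}^{n'\times n'})^{p\times q}$ is identified with the space of linear maps $\mathbb{K}^{n\times n'}\to(\mathbb{K}^{n\times n'})^{p\times q}$; thus for $H\in\mathbb{K}^{n\times n'}$, $\Delta_j(R)(Z,Z')(H)$ is a $p\times q$ block matrix with $n\times n'$ blocks, i.e., a $pn\times qn'$ matrix. Permutation matrices. $P(p,n)=[E_{ij}^{\top}]_{i=1,\ldots,p;\,j=1,\ldots,n}$ is the $pn\times pn$ permutation matrix in which $E_{ij}\in\mathbb{K}^{p\times n}$ has entry $1$ in position $(i,j)$ and zeros elsewhere. They satisfy $A\otimes B=P(n,p)(B\otimes A)P(m,q)^{\top}$ for all $A\in\mathbb{K}^{n\times m}$, $B\in\mathbb{K}^{p\times q}$ (Kronecker products). *)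

(* Defs.v *)
From mathcomp Require Import all_boot all_order all_algebra.
From mathcomp Require Import finmap.
From mathcomp Require Import mxtens.

Set Implicit Arguments.
Unset Strict Implicit.
Unset Printing Implicit Defensive.

Import GRing.Theory.
Local Open Scope ring_scope.

(* Tensor products of matrix spaces are realized by Kronecker products:
   K^(p x q) (x) K^(n x n) is 'M[K]_(p * n, q * n), the p x q block matrices
   with n x n blocks, and mxtens_index (a, i) is the position i in block a.  *)

Section BlockMatrices.
Variable K : Type.

Definition blockmx p q m n (B : 'I_p -> 'I_q -> 'M[K]_(m, n)) :
    'M[K]_(p * m, q * n) :=
  \matrix_(r, s) B (mxtens_unindex r).1 (mxtens_unindex s).1
                   (mxtens_unindex r).2 (mxtens_unindex s).2.

Definition subblock p q m n (M : 'M[K]_(p * m, q * n)) (a : 'I_p) (b : 'I_q) :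
    'M[K]_(m, n) :=
  \matrix_(i, j) M (mxtens_index (a, i)) (mxtens_index (b, j)).

End BlockMatrices.

(* P(p, n) = [E_ij^T]: it is square of size p n, the two factors being kept
   in different orders on the two sides. *)
Definition Pmx (K : fieldType) (p n : nat) : 'M[K]_(p * n, n * p) :=
  blockmx (fun (i : 'I_p) (j : 'I_n) => (delta_mx i j : 'M[K]_(p, n))^T).

Section OneTuple.
Variables (K : fieldType) (d : nat).

(* The word g_i g_j ... is [:: i; j; ...]. *)
Definition ncword := seq 'I_d.

Definition ncpoly p q := {fsfun ncword -> 'M[K]_(p, q) with 0}.

Definition mxtuple n := 'I_d -> 'M[K]_n.

Definition word_eval n (Z : mxtuple n) (w : ncword) : 'M[K]_n :=
  \prod_(i <- w) Z i.

Definition ncpoly_eval p q (P : ncpoly p q) n (Z : mxtuple n) :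
    'M[K]_(p * n, q * n) :=
  \sum_(w <- finsupp P) P w *t word_eval Z w.

Definition ncmonomial p q (C : 'M[K]_(p, q)) (w : ncword) : ncpoly p q :=
  [fsfun v in [fset w]%fset => C | 0].

(* Formal expressions; the condition that inverted expressions are not
   identically singular is imposed by is_ncrat below. *)
Inductive ncexpr : nat -> nat -> Type :=
| NCpoly p q : ncpoly p q -> ncexpr p q
| NCadd p q : ncexpr p q -> ncexpr p q -> ncexpr p q
| NCmul p r q : ncexpr p r -> ncexpr r q -> ncexpr p q
| NCinv p : ncexpr p p -> ncexpr p p
| NCblock p2 q2 p1 q1 : ('I_p2 -> 'I_q2 -> ncexpr p1 q1) ->
    ncexpr (p2 * p1) (q2 * q1).

(* Total, since invmx is; meaningful on the domain only. *)
Fixpoint nceval p q (R : ncexpr p q) n (Z : mxtuple n) {struct R} :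
    'M[K]_(p * n, q * n) :=
  match R in ncexpr p q return 'M[K]_(p * n, q * n) with
  | NCpoly _ _ P => ncpoly_eval P Z
  | NCadd _ _ R1 R2 => nceval R1 Z + nceval R2 Z
  | NCmul _ _ _ R1 R2 => nceval R1 Z *m nceval R2 Z
  | NCinv _ R1 => invmx (nceval R1 Z)
  | NCblock p2 q2 p1 q1 B =>
      castmx (mulnA p2 p1 n, mulnA q2 q1 n)
             (blockmx (fun a b => nceval (B a b) Z))
  end.

Fixpoint inverses_exist p q (R : ncexpr p q) n (Z : mxtuple n) {struct R} :
    Prop :=
  match R with
  | NCpoly _ _ _ => True
  | NCadd _ _ R1 R2 => inverses_exist R1 Z /\ inverses_exist R2 Z
  | NCmul _ _ _ R1 R2 => inverses_exist R1 Z /\ inverses_exist R2 Z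
  | NCinv _ R1 => inverses_exist R1 Z /\ nceval R1 Z \in unitmx
  | NCblock _ _ _ _ B => forall a b, inverses_exist (B a b) Z
  end.

(* The size n has to be positive: every 0 x 0 matrix is invertible, so that
   otherwise no expression would be identically singular. *)
Definition in_dom p q (R : ncexpr p q) n (Z : mxtuple n) : Prop :=
  (0 < n)%N /\ inverses_exist R Z.

Fixpoint inversions_allowed p q (R : ncexpr p q) {struct R} : Prop :=
  match R with
  | NCpoly _ _ _ => True
  | NCadd _ _ R1 R2 => inversions_allowed R1 /\ inversions_allowed R2
  | NCmul _ _ _ R1 R2 => inversions_allowed R1 /\ inversions_allowed R2
  | NCinv _ R1 => inversions_allowed R1 /\
      exists n (Z : mxtuple n), in_dom R1 Z /\ nceval R1 Z \in unitmx
  | NCblock _ _ _ _ B => forall a b, inversions_allowed (B a b)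
  end.

Definition is_ncrat p q (R : ncexpr p q) : Prop :=
  inversions_allowed R /\ exists n (Z : mxtuple n), in_dom R Z.

End OneTuple.

Section TwoTuples.
Variables (K : fieldType) (d : nat).

(* Reorders K^p (x) K^p' (x) K^n (x) K^n' as K^p (x) K^n (x) K^p' (x) K^n'. *)
Definition swap_middle p p' n n' (r : 'I_((p * p') * (n * n'))) :
    'I_((p * n) * (p' * n')) :=
  let a := mxtens_unindex (mxtens_unindex r).1 in
  let i := mxtens_unindex (mxtens_unindex r).2 in
  mxtens_index (mxtens_index (a.1, i.1), mxtens_index (a.2, i.2)).

Definition tens_values p q p' q' n n'
    (A : 'M[K]_(p * n, q * n)) (B : 'M[K]_(p' * n', q' * n')) :
    'M[K]_((p * p') * (n * n'), (q * q') * (n * n')) :=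
  mxsub (@swap_middle p p' n n') (@swap_middle q q' n n') (A *t B).

Inductive ncexpr2 : nat -> nat -> Type :=
| NC2tens p q p' q' : ncexpr K d p q -> ncexpr K d p' q' ->
    ncexpr2 (p * p') (q * q')
| NC2add p q : ncexpr2 p q -> ncexpr2 p q -> ncexpr2 p q
| NC2mul p r q : ncexpr2 p r -> ncexpr2 r q -> ncexpr2 p q
| NC2inv p : ncexpr2 p p -> ncexpr2 p p
| NC2block p2 q2 p1 q1 : ('I_p2 -> 'I_q2 -> ncexpr2 p1 q1) ->
    ncexpr2 (p2 * p1) (q2 * q1).

Fixpoint nceval2 p q (S : ncexpr2 p q) n n'
    (Z : mxtuple K d n) (Z' : mxtuple K d n') {struct S} :
    'M[K]_(p * (n * n'), q * (n * n')) :=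
  match S in ncexpr2 p q return 'M[K]_(p * (n * n'), q * (n * n')) with
  | NC2tens _ _ _ _ R R' => tens_values (nceval R Z) (nceval R' Z')
  | NC2add _ _ S1 S2 => nceval2 S1 Z Z' + nceval2 S2 Z Z'
  | NC2mul _ _ _ S1 S2 => nceval2 S1 Z Z' *m nceval2 S2 Z Z'
  | NC2inv _ S1 => invmx (nceval2 S1 Z Z')
  | NC2block p2 q2 p1 q1 B =>
      castmx (mulnA p2 p1 (n * n')%N, mulnA q2 q1 (n * n')%N)
             (blockmx (fun a b => nceval2 (B a b) Z Z'))
  end.

Fixpoint inverses_exist2 p q (S : ncexpr2 p q) n n'
    (Z : mxtuple K d n) (Z' : mxtuple K d n') {struct S} : Prop :=
  match S with
  | NC2tens _ _ _ _ R R' => inverses_exist R Z /\ inverses_exist R' Z'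
  | NC2add _ _ S1 S2 => inverses_exist2 S1 Z Z' /\ inverses_exist2 S2 Z Z'
  | NC2mul _ _ _ S1 S2 => inverses_exist2 S1 Z Z' /\ inverses_exist2 S2 Z Z'
  | NC2inv _ S1 => inverses_exist2 S1 Z Z' /\ nceval2 S1 Z Z' \in unitmx
  | NC2block _ _ _ _ B => forall a b, inverses_exist2 (B a b) Z Z'
  end.

Definition in_dom2 p q (S : ncexpr2 p q) n n'
    (Z : mxtuple K d n) (Z' : mxtuple K d n') : Prop :=
  [/\ (0 < n)%N, (0 < n')%N & inverses_exist2 S Z Z'].

Fixpoint inversions_allowed2 p q (S : ncexpr2 p q) {struct S} : Prop :=
  match S with
  | NC2tens _ _ _ _ R R' => inversions_allowed R /\ inversions_allowed R'
  | NC2add _ _ S1 S2 => inversions_allowed2 S1 /\ inversions_allowed2 S2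
  | NC2mul _ _ _ S1 S2 => inversions_allowed2 S1 /\ inversions_allowed2 S2
  | NC2inv _ S1 => inversions_allowed2 S1 /\
      exists n n' (Z : mxtuple K d n) (Z' : mxtuple K d n'),
        in_dom2 S1 Z Z' /\ nceval2 S1 Z Z' \in unitmx
  | NC2block _ _ _ _ B => forall a b, inversions_allowed2 (B a b)
  end.

Definition is_ncrat2 p q (S : ncexpr2 p q) : Prop :=
  inversions_allowed2 S /\
  exists n n' (Z : mxtuple K d n) (Z' : mxtuple K d n'), in_dom2 S Z Z'.

(* Identifies equal but not convertible sizes such as p * 1 and p. *)
Definition NC2cast p q p' q' (ep : p = p') (eq : q = q') (S : ncexpr2 p q) :
    ncexpr2 p' q' :=
  let: erefl := ep in let: erefl := eq in S.

Definition NCconst p q (C : 'M[K]_(p, q)) : ncexpr K d p q :=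
  NCpoly (ncmonomial C [::]).

Definition NC2left p q (R : ncexpr K d p q) : ncexpr2 p q :=
  NC2cast (muln1 p) (muln1 q) (NC2tens R (NCconst (1%:M : 'M[K]_1))).

Definition NC2right p q (R : ncexpr K d p q) : ncexpr2 p q :=
  NC2cast (mul1n p) (mul1n q) (NC2tens (NCconst (1%:M : 'M[K]_1)) R).

Definition NC2monomial p q (C : 'M[K]_(p, q)) (u v : ncword d) : ncexpr2 p q :=
  NC2cast (muln1 p) (muln1 q)
    (NC2tens (NCpoly (ncmonomial C u))
             (NCpoly (ncmonomial (1%:M : 'M[K]_1) v))).

Definition NC2opp p q (S : ncexpr2 p q) : ncexpr2 p q :=
  NC2mul (NC2left (NCconst (- 1%:M : 'M[K]_p))) S.

Definition NC2zero p q : ncexpr2 p q := NC2left (NCconst (0 : 'M[K]_(p, q))).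

(* The factorizations w = u g_j v correspond to the positions k of j in w. *)
Definition ncpoly_delta (j : 'I_d) p q (P : ncpoly K d p q) : ncexpr2 p q :=
  \big[@NC2add p q/NC2zero p q]_(w <- finsupp P)
    \big[@NC2add p q/NC2zero p q]_(k < size w | tnth (in_tuple w) k == j)
      NC2monomial (P w) (take k w) (drop k.+1 w).

Fixpoint Delta (j : 'I_d) p q (R : ncexpr K d p q) {struct R} : ncexpr2 p q :=
  match R in ncexpr _ _ p q return ncexpr2 p q with
  | NCpoly _ _ P => ncpoly_delta j P
  | NCadd _ _ R1 R2 => NC2add (Delta j R1) (Delta j R2)
  | NCmul _ _ _ R1 R2 =>
      NC2add (NC2mul (Delta j R1) (NC2right R2))
             (NC2mul (NC2left R1) (Delta j R2))
  | NCinv _ R1 =>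
      NC2opp (NC2mul (NC2mul (NC2left (NCinv R1)) (Delta j R1))
                     (NC2right (NCinv R1)))
  | NCblock _ _ _ _ B => NC2block (fun a b => Delta j (B a b))
  end.

End TwoTuples.

Section LinearMaps.
Variable K : fieldType.

(* The linear map with value A *m H *m B for T = A *t B, see tens_apply_tens. *)
Definition tens_apply n n' (T : 'M[K]_(n * n')) (H : 'M[K]_(n, n')) :
    'M[K]_(n, n') :=
  \matrix_(i, j') \sum_(j < n) \sum_(i' < n')
    T (mxtens_index (i, i')) (mxtens_index (j, j')) * H j i'.

Definition apply2 p q n n' (M : 'M[K]_(p * (n * n'), q * (n * n')))
    (H : 'M[K]_(n, n')) : 'M[K]_(p * n, q * n') :=
  blockmx (fun (a : 'I_p) (b : 'I_q) => tens_apply (subblock M a b) H).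

Lemma tens_apply_tens n n' (A : 'M[K]_n) (B : 'M[K]_n') (H : 'M[K]_(n, n')) :
  tens_apply (A *t B) H = A *m H *m B.
Proof.
apply/matrixP=> i j'; rewrite !mxE exchange_big /=; apply: eq_bigr=> i' _.
rewrite !mxE mulr_suml; apply: eq_bigr=> j _.
by rewrite tensmxE mulrAC.
Qed.

Lemma PmxE p n (i : 'I_p) (k : 'I_n) (j : 'I_n) (l : 'I_p) :
  Pmx K p n (mxtens_index (i, k)) (mxtens_index (j, l)) =
    ((k == j) && (l == i))%:R.
Proof. by rewrite /Pmx /blockmx !mxE !mxtens_indexK /= andbC. Qed.

Lemma tens_swap n m p q (A : 'M[K]_(n, m)) (B : 'M[K]_(p, q)) :
  A *t B = Pmx K n p *m (B *t A) *m (Pmx K m q)^T.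
Proof.
apply/matrixP=> r s; case: (mxtens_indexP r)=> i k.
case: (mxtens_indexP s)=> j l; rewrite tensmxE mxE.
rewrite (bigD1 (mxtens_index (l, j))) //= big1 => [|t]; last first.
  case: (mxtens_indexP t)=> a b nab; rewrite [(Pmx _ _ _)^T _ _]mxE PmxE.
  case: andP=> [[/eqP la /eqP bj]|]; last by rewrite mulr0.
  by rewrite la bj eqxx in nab.
rewrite addr0 [(Pmx _ _ _)^T _ _]mxE PmxE !eqxx mulr1.
rewrite [in RHS]mxE (bigD1 (mxtens_index (k, i))) //= big1 => [|t]; last first.
  case: (mxtens_indexP t)=> a b nab; rewrite PmxE.
  case: andP=> [[/eqP ka /eqP bi]|]; last by rewrite mul0r.
  by rewrite ka bi eqxx in nab.
by rewrite addr0 PmxE !eqxx mul1r tensmxE mulrC.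
Qed.

Lemma tens_values_tens p q p' q' n n' (A : 'M[K]_(p, q)) (X : 'M[K]_n)
    (B : 'M[K]_(p', q')) (Y : 'M[K]_n') :
  tens_values (A *t X) (B *t Y) = (A *t B) *t (X *t Y).
Proof.
apply/matrixP=> r s; case: (mxtens_indexP r)=> a i; case: (mxtens_indexP s)=> b j.
case: (mxtens_indexP a)=> a1 a2; case: (mxtens_indexP b)=> b1 b2.
case: (mxtens_indexP i)=> i1 i2; case: (mxtens_indexP j)=> j1 j2.
by rewrite mxE /swap_middle !mxtens_indexK /= !tensmxE mulrACA.
Qed.

Lemma apply2_tens p q n n' (C : 'M[K]_(p, q)) (A : 'M[K]_n) (B : 'M[K]_n')
    (H : 'M[K]_(n, n')) :
  apply2 (C *t (A *t B)) H = C *t (A *m H *m B).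
Proof.
apply/matrixP=> r s; case: (mxtens_indexP r)=> a i; case: (mxtens_indexP s)=> b j.
rewrite -tens_apply_tens [in RHS]tensmxE mxE !mxtens_indexK /= !mxE mulr_sumr.
apply: eq_bigr=> k _; rewrite mulr_sumr; apply: eq_bigr=> l _.
by rewrite [subblock _ _ _ _ _]mxE tensmxE mulrA.
Qed.

End LinearMaps.

Section DomainOfDelta.
Variables (K : fieldType) (d : nat).

Lemma inverses_exist2_cast p q p' q' (ep : p = p') (eq : q = q')
    (S : ncexpr2 K d p q) n n' (Z : mxtuple K d n) (Z' : mxtuple K d n') :
  inverses_exist2 (NC2cast ep eq S) Z Z' <-> inverses_exist2 S Z Z'.
Proof. by case: _ / ep; case: _ / eq. Qed.

Lemma inversions_allowed2_cast p q p' q' (ep : p = p') (eq : q = q')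
    (S : ncexpr2 K d p q) :
  inversions_allowed2 (NC2cast ep eq S) <-> inversions_allowed2 S.
Proof. by case: _ / ep; case: _ / eq. Qed.

Lemma inverses_exist2_Delta (j : 'I_d) p q (R : ncexpr K d p q) n n'
    (Z : mxtuple K d n) (Z' : mxtuple K d n') :
  inverses_exist2 (Delta j R) Z Z' <->
  inverses_exist R Z /\ inverses_exist R Z'.
Proof.
elim: R => {p q} /=.
- move=> p q P; split=> // _; rewrite /ncpoly_delta.
  elim/big_ind: _ => [|//|w _]; first exact/inverses_exist2_cast.
  elim/big_ind: _ => [|//|k _]; exact/inverses_exist2_cast.
- by move=> p q R1 IH1 R2 IH2; rewrite IH1 IH2; tauto.
- move=> p r q R1 IH1 R2 IH2.
  by rewrite IH1 IH2 !inverses_exist2_cast /=; tauto.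
- by move=> p R1 IH1; rewrite IH1 !inverses_exist2_cast /=; tauto.
- move=> p2 q2 p1 q1 B IH; split=> [H|[H H'] a b]; last exact/IH.
  by split=> a b; have /IH[] := H a b.
Qed.

Lemma in_dom2_Delta (j : 'I_d) p q (R : ncexpr K d p q) n n'
    (Z : mxtuple K d n) (Z' : mxtuple K d n') :
  in_dom2 (Delta j R) Z Z' <-> in_dom R Z /\ in_dom R Z'.
Proof.
split=> [[n0 n0' /inverses_exist2_Delta[]]|[[n0 dZ] [n0' dZ']]]; first by [].
by split=> //; apply/inverses_exist2_Delta.
Qed.

Lemma is_ncrat2_Delta (j : 'I_d) p q (R : ncexpr K d p q) :
  is_ncrat R -> is_ncrat2 (Delta j R).
Proof.
case=> iR [n [Z dZ]]; split; last first.
  by exists n, n, Z, Z; apply/in_dom2_Delta.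
elim: R iR {n Z dZ} => {p q} /=.
- move=> p q P _; rewrite /ncpoly_delta.
  elim/big_ind: _ => [|//|w _]; first exact/inversions_allowed2_cast.
  elim/big_ind: _ => [|//|k _]; exact/inversions_allowed2_cast.
- by move=> p q R1 IH1 R2 IH2 [/IH1 ? /IH2 ?].
- move=> p r q R1 IH1 R2 IH2 [i1 i2]; rewrite !inversions_allowed2_cast /=.
  by move: (IH1 i1) (IH2 i2); tauto.
- move=> p R1 IH1 [i1 ex1]; rewrite !inversions_allowed2_cast /=.
  by move: (IH1 i1); tauto.
- by move=> p2 q2 p1 q1 B IH iB a b; apply: IH.
Qed.

End DomainOfDelta.

(* Main.v *)
(* For tuples of block upper triangular matrices with corner W, the value of R
   is again block upper triangular once its n + n' rows and columns are
   regrouped, and its corner, as a function of R, satisfies the same sum,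
   product, inverse and block rules as sum_j Delta_j(R)(Z, Z')(W_j); on words it
   is sum_k Z^(w_1..w_(k-1)) W_(w_k) Z'^(w_(k+1)..).  Induction on R
   gives both the domain claim and the formula; P(n + n', p) performs the
   regrouping. *)
Require Import Defs.
From mathcomp Require Import all_boot all_order all_algebra.
From mathcomp Require Import finmap mxtens.

Set Implicit Arguments.
Unset Strict Implicit.
Unset Printing Implicit Defensive.

Import GRing.Theory.
Local Open Scope ring_scope.

(** * Index pairs, associativity and distributivity casts, and the splitting of [n + n'] inside each
    block *)

Section TensorIndices.

Lemma mxtens_index_inj m n : injective (@mxtens_index m n).
Proof. exact: can_inj (@mxtens_indexK m n). Qed.

Lemma matrix_tensP (T : Type) p q m n (M N : 'M[T]_(p * m, q * n)) :
  (forall a i b j, M (mxtens_index (a, i)) (mxtens_index (b, j)) =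
                   N (mxtens_index (a, i)) (mxtens_index (b, j))) -> M = N.
Proof.
move=> eqMN; apply/matrixP=> r s.
by case: (mxtens_indexP r)=> a i; case: (mxtens_indexP s)=> b j.
Qed.

Lemma sum_tens (V : nmodType) m n (F : 'I_(m * n) -> V) :
  \sum_r F r = \sum_i \sum_j F (mxtens_index (i, j)).
Proof.
rewrite pair_bigA (reindex (@mxtens_index m n)) /=.
  by apply: eq_bigr=> -[i j] _.
by exists (@mxtens_unindex m n)=> r _; rewrite (mxtens_indexK, mxtens_unindexK).
Qed.

Lemma cast_ord_mulnA p2 p1 n (a : 'I_p2) (b : 'I_p1) (i : 'I_n) :
  cast_ord (esym (mulnA p2 p1 n)) (mxtens_index (mxtens_index (a, b), i)) =
  mxtens_index (a, mxtens_index (b, i)).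
Proof. by apply: val_inj; rewrite /= mulnDl mulnA addnA. Qed.

(** In pairs [(i, a)] the index from [n + n'] varies slowest, so a plain cast already separates the
    two summands. This is why multiplication by the matrices [Pmx] ends in a genuine [block_mx]. *)
Lemma cast_ord_mulnDl_lshift n n' p (i : 'I_n) (a : 'I_p) :
  cast_ord (esym (mulnDl n n' p)) (lshift (n' * p) (mxtens_index (i, a))) =
  mxtens_index (lshift n' i, a).
Proof. exact: val_inj. Qed.

Lemma cast_ord_mulnDl_rshift n n' p (i : 'I_n') (a : 'I_p) :
  cast_ord (esym (mulnDl n n' p)) (rshift (n * p) (mxtens_index (i, a))) =
  mxtens_index (rshift n i, a).
Proof. by apply: val_inj; rewrite /= mulnDl addnA. Qed.

(* Position (a, i) of the first, resp. second, summand goes to row i, resp. n + i,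
   of block a. *)
Definition interleave p n n' (r : 'I_(p * n + p * n')) : 'I_(p * (n + n')) :=
  match split r with
  | inl s => mxtens_index ((mxtens_unindex s).1, lshift n' (mxtens_unindex s).2)
  | inr s => mxtens_index ((mxtens_unindex s).1, rshift n (mxtens_unindex s).2)
  end.

Definition deinterleave p n n' (r : 'I_(p * (n + n'))) : 'I_(p * n + p * n') :=
  match split (mxtens_unindex r).2 with
  | inl i => lshift (p * n') (mxtens_index ((mxtens_unindex r).1, i))
  | inr i => rshift (p * n) (mxtens_index ((mxtens_unindex r).1, i))
  end.

Lemma interleave_lshift p n n' (a : 'I_p) (i : 'I_n) :
  interleave (lshift (p * n') (mxtens_index (a, i))) =
  mxtens_index (a, lshift n' i).
Proof. by rewrite /interleave (unsplitK (inl _)) mxtens_indexK. Qed.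

Lemma interleave_rshift p n n' (a : 'I_p) (i : 'I_n') :
  interleave (rshift (p * n) (mxtens_index (a, i))) =
  mxtens_index (a, rshift n i).
Proof. by rewrite /interleave (unsplitK (inr _)) mxtens_indexK. Qed.

Lemma interleaveK p n n' : cancel (@interleave p n n') (@deinterleave p n n').
Proof.
move=> r; rewrite -[r]splitK; case: (split r)=> s; case: (mxtens_indexP s)=> a i.
  by rewrite interleave_lshift /deinterleave mxtens_indexK (unsplitK (inl _)).
by rewrite interleave_rshift /deinterleave mxtens_indexK (unsplitK (inr _)).
Qed.

Lemma deinterleaveK p n n' : cancel (@deinterleave p n n') (@interleave p n n').
Proof.
move=> r; case: (mxtens_indexP r)=> a k; rewrite -[k]splitK.
rewrite /deinterleave mxtens_indexK unsplitK.
by case: (split k)=> i; rewrite (interleave_lshift, interleave_rshift).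
Qed.

End TensorIndices.

Lemma sum_block_mx (V : nmodType) m1 m2 n1 n2 (I : Type) (s : seq I)
    (A : I -> 'M[V]_(m1, n1)) B (C : I -> 'M[V]_(m2, n1)) (D : I -> 'M_(m2, n2)) :
  \sum_(k <- s) block_mx (A k) (B k) (C k) (D k) =
  block_mx (\sum_(k <- s) A k) (\sum_(k <- s) B k)
           (\sum_(k <- s) C k) (\sum_(k <- s) D k).
Proof.
elim: s => [|k s IHs]; first by rewrite !big_nil block_mx0.
by rewrite !big_cons IHs add_block_mx.
Qed.

(** * Regrouping rows and columns into block form, and its relation to the permutation matrices *)

Section Interleave.
Variable K : fieldType.

(** Each row of [Pmx] has a single 1, so both matrix products collapse to one term. This extends the
    exchange of tensor factors to matrices that are not Kronecker products. *)
Lemma Pmx_conj p q n m (M : 'M[K]_(p * n, q * m)) i a j b :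
  (Pmx K n p *m M *m (Pmx K m q)^T) (mxtens_index (i, a)) (mxtens_index (j, b)) =
  M (mxtens_index (a, i)) (mxtens_index (b, j)).
Proof.
rewrite mxE (bigD1 (mxtens_index (b, j))) //= big1 => [|t]; last first.
  case: (mxtens_indexP t)=> c k nck; rewrite [(Pmx _ _ _)^T _ _]mxE PmxE.
  case: andP=> [[/eqP bc /eqP kj]|]; last by rewrite mulr0.
  by rewrite bc kj eqxx in nck.
rewrite addr0 [(Pmx _ _ _)^T _ _]mxE PmxE !eqxx mulr1.
rewrite [in LHS]mxE (bigD1 (mxtens_index (a, i))) //= big1 => [|t]; last first.
  case: (mxtens_indexP t)=> c k nck; rewrite PmxE.
  case: andP=> [[/eqP ac /eqP ki]|]; last by rewrite mul0r.
  by rewrite ac ki eqxx in nck.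
by rewrite addr0 PmxE !eqxx mul1r.
Qed.

(** Row and column permutation, written as reindexing. It keeps the order of the blocks and only
    separates their [n] and [n'] parts, so the algebraic rules can be stated with [block_mx]. *)
Definition regroup p q n n' (M : 'M[K]_(p * (n + n'), q * (n + n'))) :
    'M[K]_(p * n + p * n', q * n + q * n') :=
  mxsub (@interleave p n n') (@interleave q n n') M.

Lemma regroupE p q n n' (M : 'M[K]_(p * (n + n'), q * (n + n'))) r s :
  regroup M r s = M (interleave r) (interleave s).
Proof. exact: mxE. Qed.

Lemma regroupD p q n n' (M N : 'M[K]_(p * (n + n'), q * (n + n'))) :
  regroup (M + N) = regroup M + regroup N.
Proof. by apply/matrixP=> r s; rewrite !mxE. Qed.

Lemma regroup0 p q n n' :
  regroup (0 : 'M[K]_(p * (n + n'), q * (n + n'))) = 0.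
Proof. by apply/matrixP=> r s; rewrite !mxE. Qed.

(** [interleave] is a bijection, so the inner summation index of the product can be reindexed along
    it. *)
Lemma regroup_mul p t q n n' (M : 'M[K]_(p * (n + n'), t * (n + n')))
    (N : 'M[K]_(t * (n + n'), q * (n + n'))) :
  regroup (M *m N) = regroup M *m regroup N.
Proof.
apply/matrixP=> r s; rewrite !mxE (reindex (@interleave t n n')) /=; last first.
  by exists (@deinterleave t n n')=> k _; rewrite (interleaveK, deinterleaveK).
by apply: eq_bigr=> k _; rewrite !mxE.
Qed.

Lemma regroup1 p n n' : regroup (1%:M : 'M[K]_(p * (n + n'))) = 1%:M.
Proof.
by apply/matrixP=> r s; rewrite !mxE (inj_eq (can_inj (@interleaveK p n n'))).
Qed.

Lemma regroup_inj p q n n' : injective (@regroup p q n n').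
Proof.
move=> M N /matrixP eqMN; apply/matrixP=> r s.
have := eqMN (deinterleave r) (deinterleave s).
by rewrite !mxE !deinterleaveK.
Qed.

Lemma regroup_surj p q n n' (N : 'M[K]_(p * n + p * n', q * n + q * n')) :
  exists M, regroup M = N.
Proof.
exists (mxsub (@deinterleave p n n') (@deinterleave q n n') N).
by apply/matrixP=> r s; rewrite !mxE !interleaveK.
Qed.

(** The source of the domain claim: the usual inverse of a block triangular matrix is pulled back
    along [regroup] to a right inverse of [M], which suffices because [M] is square. *)
Lemma regroup_inv p n n' (M : 'M[K]_(p * (n + n'))) A X B :
    A \in unitmx -> B \in unitmx -> regroup M = block_mx A X 0 B ->
  M \in unitmx /\ regroup (invmx M) =
    block_mx (invmx A) (- (invmx A *m X *m invmx B)) 0 (invmx B).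
Proof.
move=> uA uB eqM.
have [N eqN] := regroup_surj
  (block_mx (invmx A) (- (invmx A *m X *m invmx B)) 0 (invmx B)).
have MN : M *m N = 1%:M.
  (* After regrouping, the corner of the product is [- X *m invmx B + X *m invmx B], which
     vanishes. *)
  apply: regroup_inj; rewrite regroup_mul eqM eqN regroup1 mulmx_block.
  rewrite !mulmx0 !mul0mx !mulmxV // !addr0 add0r mulmxN -!mulmxA mulKVmx //.
  by rewrite addNr -scalar_mx_block.
have [uM _] := mulmx1_unit MN.
by split=> //; rewrite -eqN -[N](mulKmx uM) MN mulmx1.
Qed.

Lemma regroup_blockE p q n n' (M : 'M[K]_(p * (n + n'), q * (n + n'))) A X C B :
  regroup M = block_mx A X C B <->
  forall a b,
    [/\ forall i j, M (mxtens_index (a, lshift n' i)) (mxtens_index (b, lshift n' j)) =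
          A (mxtens_index (a, i)) (mxtens_index (b, j)),
        forall i j, M (mxtens_index (a, lshift n' i)) (mxtens_index (b, rshift n j)) =
          X (mxtens_index (a, i)) (mxtens_index (b, j)),
        forall i j, M (mxtens_index (a, rshift n i)) (mxtens_index (b, lshift n' j)) =
          C (mxtens_index (a, i)) (mxtens_index (b, j)) &
        forall i j, M (mxtens_index (a, rshift n i)) (mxtens_index (b, rshift n j)) =
          B (mxtens_index (a, i)) (mxtens_index (b, j))].
Proof.
split=> [/matrixP eqM a b | eqM].
  split=> i j; rewrite -?interleave_lshift -?interleave_rshift.
  - by rewrite -regroupE eqM block_mxEul.
  - by rewrite -regroupE eqM block_mxEur.
  - by rewrite -regroupE eqM block_mxEdl.
  - by rewrite -regroupE eqM block_mxEdr.
apply/matrixP=> r s; rewrite mxE -[r]splitK -[s]splitK.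
case: (split r)=> {}r; case: (split s)=> {}s; rewrite /unsplit;
  case: (mxtens_indexP r)=> a i; case: (mxtens_indexP s)=> b j;
  have [Mul Mur Mdl Mdr] := eqM a b.
- by rewrite !interleave_lshift Mul block_mxEul.
- by rewrite interleave_lshift interleave_rshift Mur block_mxEur.
- by rewrite interleave_lshift interleave_rshift Mdl block_mxEdl.
- by rewrite !interleave_rshift Mdr block_mxEdr.
Qed.

Lemma regroup_tens p q n n' (C : 'M[K]_(p, q)) A X D B :
  regroup (C *t (block_mx A X D B : 'M[K]_(n + n', n + n'))) =
  block_mx (C *t A) (C *t X) (C *t D) (C *t B).
Proof.
apply/regroup_blockE=> a b; split=> i j; rewrite !tensmxE.
- by rewrite block_mxEul.
- by rewrite block_mxEur.
- by rewrite block_mxEdl.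
- by rewrite block_mxEdr.
Qed.

(** The shape in which [nceval] and [nceval2] evaluate block expressions. The inner sizes [m] and
    [n] may differ, so that it also covers the [n] by [n'] corner. *)
Definition flatten_blocks p2 q2 p1 q1 m n
    (B : 'I_p2 -> 'I_q2 -> 'M[K]_(p1 * m, q1 * n)) :
    'M[K]_(p2 * p1 * m, q2 * q1 * n) :=
  castmx (mulnA p2 p1 m, mulnA q2 q1 n) (blockmx B).

Lemma flatten_blocksE p2 q2 p1 q1 m n
    (B : 'I_p2 -> 'I_q2 -> 'M[K]_(p1 * m, q1 * n)) a2 a1 i b2 b1 j :
  flatten_blocks B (mxtens_index (mxtens_index (a2, a1), i))
                   (mxtens_index (mxtens_index (b2, b1), j)) =
  B a2 b2 (mxtens_index (a1, i)) (mxtens_index (b1, j)).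
Proof. by rewrite castmxE /= !cast_ord_mulnA mxE !mxtens_indexK. Qed.

Lemma flatten_blocks0 p2 q2 p1 q1 m n :
  flatten_blocks (fun _ _ => 0) = 0 :> 'M[K]_(p2 * p1 * m, q2 * q1 * n).
Proof.
apply/matrix_tensP=> a i b j; case: (mxtens_indexP a)=> a2 a1.
by case: (mxtens_indexP b)=> b2 b1; rewrite flatten_blocksE !mxE.
Qed.

Lemma flatten_blocks_sum (I : finType) p2 q2 p1 q1 m n
    (B : I -> 'I_p2 -> 'I_q2 -> 'M[K]_(p1 * m, q1 * n)) :
  \sum_k flatten_blocks (B k) = flatten_blocks (fun a b => \sum_k B k a b).
Proof.
apply/matrix_tensP=> a i b j; case: (mxtens_indexP a)=> a2 a1.
case: (mxtens_indexP b)=> b2 b1; rewrite flatten_blocksE !summxE.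
by apply: eq_bigr=> k _; rewrite flatten_blocksE.
Qed.

(** Regrouping splits only the innermost index, while flattening merges the two outer ones, so the
    operations commute. *)
Lemma regroup_flatten_blocks p2 q2 p1 q1 n n'
    (M : 'I_p2 -> 'I_q2 -> 'M[K]_(p1 * (n + n'), q1 * (n + n'))) A X C B :
  (forall a b, regroup (M a b) = block_mx (A a b) (X a b) (C a b) (B a b)) ->
  regroup (flatten_blocks M) =
    block_mx (flatten_blocks A) (flatten_blocks X)
             (flatten_blocks C) (flatten_blocks B).
Proof.
move=> eqM; apply/regroup_blockE=> a b.
case: (mxtens_indexP a)=> a2 a1; case: (mxtens_indexP b)=> b2 b1.
have /regroup_blockE/(_ a1 b1)[Mul Mur Mdl Mdr] := eqM a2 b2.
by split=> i j; rewrite !flatten_blocksE.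
Qed.

(** The permutation matrices move the index from [n + n'] to the outermost place, where its
    splitting becomes the splitting of the whole matrix. Each of the four blocks then undergoes the
    same exchange of factors. *)
Lemma Pmx_conj_regroup p q n n' (M : 'M[K]_(p * (n + n'), q * (n + n'))) A X B :
    regroup M = block_mx A X 0 B ->
  castmx (mulnDl n n' p, mulnDl n n' q)
    (Pmx K (n + n') p *m M *m (Pmx K (n + n') q)^T) =
  block_mx (Pmx K n p *m A *m (Pmx K n q)^T) (Pmx K n p *m X *m (Pmx K n' q)^T)
           0 (Pmx K n' p *m B *m (Pmx K n' q)^T).
Proof.
move=> /regroup_blockE eqM; apply/matrixP=> r s; rewrite castmxE /=.
rewrite -[r]splitK -[s]splitK.
case: (split r)=> {}r; case: (split s)=> {}s; rewrite /unsplit;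
  case: (mxtens_indexP r)=> i a; case: (mxtens_indexP s)=> j b;
  have [Mul Mur Mdl Mdr] := eqM a b;
  rewrite ?cast_ord_mulnDl_lshift ?cast_ord_mulnDl_rshift Pmx_conj.
- by rewrite Mul block_mxEul Pmx_conj.
- by rewrite Mur block_mxEur Pmx_conj.
- by rewrite Mdl block_mxEdl !mxE.
- by rewrite Mdr block_mxEdr Pmx_conj.
Qed.

End Interleave.

(** * Linearity of [apply2] in the tensor, and its compatibility with block matrices *)

Section Apply2.
Variable K : fieldType.

Lemma apply2E p q n n' (M : 'M[K]_(p * (n * n'), q * (n * n')))
    (H : 'M[K]_(n, n')) a i b j' :
  apply2 M H (mxtens_index (a, i)) (mxtens_index (b, j')) =
  \sum_j \sum_i' M (mxtens_index (a, mxtens_index (i, i')))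
                   (mxtens_index (b, mxtens_index (j, j'))) * H j i'.
Proof.
rewrite mxE !mxtens_indexK /= mxE; apply: eq_bigr=> j _; apply: eq_bigr=> i' _.
by rewrite mxE.
Qed.

Lemma apply2D p q n n' (M N : 'M[K]_(p * (n * n'), q * (n * n')))
    (H : 'M[K]_(n, n')) :
  apply2 (M + N) H = apply2 M H + apply2 N H.
Proof.
apply/matrix_tensP=> a i b j'; rewrite [RHS]mxE !apply2E -big_split /=.
apply: eq_bigr=> j _; rewrite -big_split /=; apply: eq_bigr=> i' _.
by rewrite mxE mulrDl.
Qed.

Lemma apply20 p q n n' (H : 'M[K]_(n, n')) :
  apply2 (0 : 'M[K]_(p * (n * n'), q * (n * n'))) H = 0.
Proof.
apply/matrix_tensP=> a i b j'; rewrite [RHS]mxE apply2E.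
by rewrite big1 // => j _; rewrite big1 // => i' _; rewrite mxE mul0r.
Qed.

Lemma apply2_sum p q n n' (I : Type) (s : seq I) (Q : pred I)
    (M : I -> 'M[K]_(p * (n * n'), q * (n * n'))) (H : 'M[K]_(n, n')) :
  apply2 (\sum_(k <- s | Q k) M k) H = \sum_(k <- s | Q k) apply2 (M k) H.
Proof.
by apply: (big_morph (fun N => apply2 N H))=> [N N'|]; rewrite (apply2D, apply20).
Qed.

Lemma apply2_flatten_blocks p2 q2 p1 q1 n n'
    (M : 'I_p2 -> 'I_q2 -> 'M[K]_(p1 * (n * n'), q1 * (n * n')))
    (H : 'M[K]_(n, n')) :
  apply2 (flatten_blocks M) H = flatten_blocks (fun a b => apply2 (M a b) H).
Proof.
apply/matrix_tensP=> a i b j'; case: (mxtens_indexP a)=> a2 a1.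
case: (mxtens_indexP b)=> b2 b1; rewrite flatten_blocksE !apply2E.
apply: eq_bigr=> j _; apply: eq_bigr=> i' _.
by rewrite flatten_blocksE.
Qed.

End Apply2.

(** * Values of the expressions from which [Delta] is built, and their action as linear maps *)

Section Evaluation.
Variables (K : fieldType) (d : nat).

Lemma word_eval_nil n (Z : mxtuple K d n) : word_eval Z [::] = 1%:M.
Proof. exact: big_nil. Qed.

Lemma word_eval_cons n (Z : mxtuple K d n) i (w : ncword d) :
  word_eval Z (i :: w) = Z i *m word_eval Z w.
Proof. exact: big_cons. Qed.

Lemma nceval_monomial p q (C : 'M[K]_(p, q)) (w : ncword d) n
    (Z : mxtuple K d n) :
  nceval (NCpoly (ncmonomial C w)) Z = C *t word_eval Z w.
Proof.
(* For [C = 0] the support is empty, so the sum is first enlarged to the singleton of [w]; a term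
   added this way is zero. *)
rewrite /= /ncpoly_eval (@big_fset_incl _ _ _ _ _ [fset w]%fset).
- by rewrite big_seq_fset1 fsfunE inE eqxx.
- exact: finsupp_sub.
- move=> v; rewrite inE=> /eqP -> {v}; rewrite memNfinsupp => /eqP ->.
  exact: tens0mx.
Qed.

Lemma nceval_const p q (C : 'M[K]_(p, q)) n (Z : mxtuple K d n) :
  nceval (NCconst d C) Z = C *t 1%:M.
Proof. by rewrite nceval_monomial word_eval_nil. Qed.

(** Evaluation does not compute through the transport in [NC2cast]. Destructing the size equalities
    reduces the entry formula to identity casts. *)
Lemma nceval2_castE p q p' q' (ep : p = p') (eq : q = q')
    (S : ncexpr2 K d p q) n n' (Z : mxtuple K d n) (Z' : mxtuple K d n') a i b j :
  nceval2 (NC2cast ep eq S) Z Z' (mxtens_index (a, i)) (mxtens_index (b, j)) =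
  nceval2 S Z Z' (mxtens_index (cast_ord (esym ep) a, i))
                 (mxtens_index (cast_ord (esym eq) b, j)).
Proof. by case: _ / ep a; case: _ / eq b => b a; rewrite !cast_ord_id. Qed.

Lemma cast_ord_muln1 p (a : 'I_p) :
  cast_ord (esym (muln1 p)) a = mxtens_index (a, ord0).
Proof. by apply: val_inj; rewrite /= muln1 addn0. Qed.

Lemma cast_ord_mul1n p (a : 'I_p) :
  cast_ord (esym (mul1n p)) a = mxtens_index (ord0, a).
Proof. exact: val_inj. Qed.

Variables (n n' : nat) (Z : mxtuple K d n) (Z' : mxtuple K d n').

Lemma nceval2_tensE p q p' q' (R : ncexpr K d p q) (R' : ncexpr K d p' q')
    a a' i i' b b' j j' :
  nceval2 (NC2tens R R') Z Z'
    (mxtens_index (mxtens_index (a, a'), mxtens_index (i, i')))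
    (mxtens_index (mxtens_index (b, b'), mxtens_index (j, j'))) =
  nceval R Z (mxtens_index (a, i)) (mxtens_index (b, j)) *
  nceval R' Z' (mxtens_index (a', i')) (mxtens_index (b', j')).
Proof. by rewrite /= mxE /swap_middle !mxtens_indexK /= tensmxE. Qed.

Lemma nceval2_monomial p q (C : 'M[K]_(p, q)) (u v : ncword d) :
  nceval2 (NC2monomial C u v) Z Z' = C *t (word_eval Z u *t word_eval Z' v).
Proof.
apply/matrix_tensP=> a i b j; rewrite nceval2_castE !cast_ord_muln1.
case: (mxtens_indexP i)=> i1 i2; case: (mxtens_indexP j)=> j1 j2.
by rewrite nceval2_tensE !nceval_monomial !tensmxE mxE mul1r mulrA.
Qed.

Lemma nceval2_leftE p q (R : ncexpr K d p q) a i i' b j j' :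
  nceval2 (NC2left R) Z Z' (mxtens_index (a, mxtens_index (i, i')))
                           (mxtens_index (b, mxtens_index (j, j'))) =
  nceval R Z (mxtens_index (a, i)) (mxtens_index (b, j)) * (i' == j')%:R.
Proof.
rewrite nceval2_castE !cast_ord_muln1 nceval2_tensE nceval_const tensmxE.
by rewrite !mxE mul1r.
Qed.

Lemma nceval2_rightE p q (R : ncexpr K d p q) a i i' b j j' :
  nceval2 (NC2right R) Z Z' (mxtens_index (a, mxtens_index (i, i')))
                            (mxtens_index (b, mxtens_index (j, j'))) =
  (i == j)%:R * nceval R Z' (mxtens_index (a, i')) (mxtens_index (b, j')).
Proof.
rewrite nceval2_castE !cast_ord_mul1n nceval2_tensE nceval_const tensmxE.
by rewrite !mxE mul1r.
Qed.

Lemma nceval2_zero p q : nceval2 (NC2zero K d p q) Z Z' = 0.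
Proof.
apply/matrix_tensP=> a i b j.
case: (mxtens_indexP i)=> i1 i2; case: (mxtens_indexP j)=> j1 j2.
by rewrite nceval2_leftE nceval_const tens0mx !mxE mul0r.
Qed.

(** [NC2add] is a bare constructor without monoid laws. It is enough that evaluation sends it to
    addition and [NC2zero] to 0. *)
Lemma nceval2_sum p q (I : Type) (s : seq I) (P : pred I)
    (F : I -> ncexpr2 K d p q) :
  nceval2 (\big[@NC2add K d p q/NC2zero K d p q]_(k <- s | P k) F k) Z Z' =
  \sum_(k <- s | P k) nceval2 (F k) Z Z'.
Proof.
by apply: (big_morph (fun S => nceval2 S Z Z'))=> //; apply: nceval2_zero.
Qed.

(** The tensor of R with 1 acts on the left of H only, so it factors out of the linear map as a left
    multiplication. With its right-hand counterpart this gives the product and inverse rules. *)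
Lemma apply2_mul_left p t q (R : ncexpr K d p t)
    (M : 'M[K]_(t * (n * n'), q * (n * n'))) (H : 'M[K]_(n, n')) :
  apply2 (nceval2 (NC2left R) Z Z' *m M) H = nceval R Z *m apply2 M H.
Proof.
apply/matrix_tensP=> a i b j'; rewrite apply2E mxE sum_tens.
transitivity (\sum_j \sum_i' \sum_c \sum_k
    nceval R Z (mxtens_index (a, i)) (mxtens_index (c, k)) *
    (M (mxtens_index (c, mxtens_index (k, i')))
       (mxtens_index (b, mxtens_index (j, j'))) * H j i')).
  apply: eq_bigr=> j _; apply: eq_bigr=> i' _; rewrite mxE sum_tens mulr_suml.
  apply: eq_bigr=> c _; rewrite sum_tens mulr_suml; apply: eq_bigr=> k _.
  (* The left factor is diagonal in the second tensor index, so only [l = i'] survives. *)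
  rewrite (bigD1 i') //= big1 => [|l /negPf nl].
    by rewrite nceval2_leftE eqxx mulr1 addr0 mulrA.
  by rewrite nceval2_leftE eq_sym nl mulr0 mul0r.
(* The sums over [c] and then [k] move out past those over [j] and [i'], which exposes the
   row-column product. *)
under eq_bigr=> j _ do rewrite exchange_big /=.
rewrite exchange_big; apply: eq_bigr=> c _ /=.
under eq_bigr=> j _ do rewrite exchange_big /=.
rewrite exchange_big; apply: eq_bigr=> k _ /=.
rewrite apply2E mulr_sumr; apply: eq_bigr=> j _.
by rewrite mulr_sumr.
Qed.

Lemma apply2_mul_right p t q (M : 'M[K]_(p * (n * n'), t * (n * n')))
    (R : ncexpr K d t q) (H : 'M[K]_(n, n')) :
  apply2 (M *m nceval2 (NC2right R) Z Z') H = apply2 M H *m nceval R Z'.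
Proof.
apply/matrix_tensP=> a i b j'; rewrite apply2E mxE sum_tens.
transitivity (\sum_j \sum_i' \sum_c \sum_k'
    M (mxtens_index (a, mxtens_index (i, i')))
      (mxtens_index (c, mxtens_index (j, k'))) * H j i' *
    nceval R Z' (mxtens_index (c, k')) (mxtens_index (b, j'))).
  apply: eq_bigr=> j _; apply: eq_bigr=> i' _; rewrite mxE sum_tens mulr_suml.
  (* Here the right factor is diagonal in the first tensor index, so only [l = j] survives. *)
  apply: eq_bigr=> c _; rewrite sum_tens (bigD1 j) //= [X in _ + X]big1.
    rewrite addr0 mulr_suml; apply: eq_bigr=> k' _.
    by rewrite nceval2_rightE eqxx mul1r mulrAC.
  move=> l /negPf nl; rewrite big1 // => k' _.
  by rewrite nceval2_rightE nl mul0r mulr0.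
under eq_bigr=> j _ do rewrite exchange_big /=.
rewrite exchange_big; apply: eq_bigr=> c _ /=.
under eq_bigr=> j _ do rewrite exchange_big /=.
rewrite exchange_big; apply: eq_bigr=> k' _ /=.
rewrite apply2E mulr_suml; apply: eq_bigr=> j _.
by rewrite mulr_suml.
Qed.

Lemma tens_scalar1 p m : (1%:M : 'M[K]_p) *t (1%:M : 'M[K]_m) = 1%:M.
Proof.
apply/matrix_tensP=> a i b j; rewrite tensmxE !mxE -natrM mulnb.
by rewrite (inj_eq (@mxtens_index_inj p m)) xpair_eqE.
Qed.

(** [NC2opp] encodes the sign as a left multiplication by the constant expression -1, so
    [apply2_mul_left] applies. *)
Lemma apply2_opp p q (S : ncexpr2 K d p q) (H : 'M[K]_(n, n')) :
  apply2 (nceval2 (NC2opp S) Z Z') H = - apply2 (nceval2 S Z Z') H.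
Proof.
rewrite /= apply2_mul_left nceval_const.
rewrite (_ : - 1%:M *t 1%:M = - 1%:M) ?mulNmx ?mul1mx //.
rewrite -tens_scalar1; apply/matrix_tensP=> a i b j.
by rewrite [RHS]mxE !tensmxE [in LHS]mxE mulNr.
Qed.

End Evaluation.

(** * Evaluation at block upper triangular tuples *)

Section Bidiagonal.
Variables (K : fieldType) (d n n' : nat).
Variables (Z : mxtuple K d n) (Z' : mxtuple K d n') (W : 'I_d -> 'M[K]_(n, n')).

Definition bidiag : mxtuple K d (n + n') :=
  fun j => block_mx (Z j) (W j) 0 (Z' j).

Definition delta_sum p q (R : ncexpr K d p q) : 'M[K]_(p * n, q * n') :=
  \sum_j apply2 (nceval2 (Delta j R) Z Z') (W j).

Definition word_delta (w : ncword d) : 'M[K]_(n, n') :=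
  \sum_(k < size w) word_eval Z (take k w) *m W (tnth (in_tuple w) k)
                      *m word_eval Z' (drop k.+1 w).

Lemma word_eval_bidiag (w : ncword d) :
  word_eval bidiag w =
  block_mx (word_eval Z w) (word_delta w) 0 (word_eval Z' w).
Proof.
elim: w => [|i w IHw].
  by rewrite !word_eval_nil /word_delta big_ord0 -scalar_mx_block.
rewrite !word_eval_cons IHw mulmx_block !mulmx0 !mul0mx !addr0 add0r; congr block_mx.
(* Position 0 contributes [W i *m word_eval Z' w]; at every later position [Z i] is the leftmost
   factor. *)
rewrite /word_delta /= big_ord_recl /= drop0 word_eval_nil mul1mx.
rewrite addrC; congr (_ + _); rewrite mulmx_sumr; apply: eq_bigr=> k _.
(* Passing to [nth], with [i] as default, identifies the letter at position [k.+1] of [i :: w] with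
   that at [k] of [w]. *)
by rewrite /= word_eval_cons !mulmxA !(tnth_nth i).
Qed.

(** A position in a word contributes to [Delta j] for exactly one [j], the letter found there.
    Summing over [j] therefore removes the restriction on positions. *)
Lemma delta_sum_poly p q (P : ncpoly K d p q) :
  delta_sum (NCpoly P) = \sum_(w <- finsupp P) P w *t word_delta w.
Proof.
transitivity (\sum_j \sum_(w <- finsupp P)
    \sum_(k < size w | tnth (in_tuple w) k == j)
      P w *t (word_eval Z (take k w) *m W j *m word_eval Z' (drop k.+1 w))).
  apply: eq_bigr=> j _; rewrite /= /ncpoly_delta nceval2_sum apply2_sum.
  apply: eq_bigr=> w _; rewrite nceval2_sum apply2_sum.
  by apply: eq_bigr=> k _; rewrite nceval2_monomial apply2_tens.
rewrite exchange_big; apply: eq_bigr=> w _ /=.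
rewrite (exchange_big_dep predT) //= /word_delta.
apply/matrix_tensP=> a i b j; rewrite tensmxE !summxE mulr_sumr.
apply: eq_bigr=> k _; rewrite (eq_bigl (pred1 (tnth (in_tuple w) k))) //.
by rewrite big_pred1_eq tensmxE.
Qed.

Lemma delta_sumD p q (R1 R2 : ncexpr K d p q) :
  delta_sum (NCadd R1 R2) = delta_sum R1 + delta_sum R2.
Proof. by rewrite -big_split; apply: eq_bigr=> j _ /=; rewrite apply2D. Qed.

(** The summands are ordered as in the corner of a product of two block upper triangular
    matrices. *)
Lemma delta_sumM p t q (R1 : ncexpr K d p t) (R2 : ncexpr K d t q) :
  delta_sum (NCmul R1 R2) =
  nceval R1 Z *m delta_sum R2 + delta_sum R1 *m nceval R2 Z'.
Proof.
rewrite mulmx_sumr mulmx_suml -big_split; apply: eq_bigr=> j _ /=.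
by rewrite apply2D apply2_mul_left apply2_mul_right addrC.
Qed.

Lemma delta_sumV p (R : ncexpr K d p p) :
  delta_sum (NCinv R) =
  - (invmx (nceval R Z) *m delta_sum R *m invmx (nceval R Z')).
Proof.
rewrite mulmx_sumr mulmx_suml -sumrN; apply: eq_bigr=> j _.
by rewrite [Delta _ _]/= apply2_opp /= apply2_mul_right apply2_mul_left.
Qed.

Lemma delta_sum_block p2 q2 p1 q1 (B : 'I_p2 -> 'I_q2 -> ncexpr K d p1 q1) :
  delta_sum (NCblock B) = flatten_blocks (fun a b => delta_sum (B a b)).
Proof.
rewrite -flatten_blocks_sum; apply: eq_bigr=> j _.
exact: apply2_flatten_blocks.
Qed.

(** The two conclusions are proved together because, for an inverse, membership in the domain rests
    on the triangular form of the value being inverted. *)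
Lemma nceval_bidiag p q (R : ncexpr K d p q) :
    inverses_exist R Z -> inverses_exist R Z' ->
  inverses_exist R bidiag /\
  regroup (nceval R bidiag) =
    block_mx (nceval R Z) (delta_sum R) 0 (nceval R Z').
Proof.
elim: R => {p q} /=.
- move=> p q P _ _; split=> //; rewrite delta_sum_poly /ncpoly_eval.
  rewrite (big_morph _ (@regroupD _ _ _ _ _) (@regroup0 _ _ _ _ _)).
  under eq_bigr do rewrite word_eval_bidiag regroup_tens tensmx0.
  by rewrite sum_block_mx [X in block_mx _ _ X _]big1.
- move=> p q R1 IH1 R2 IH2 [d1 d2] [d1' d2'].
  have [? e1] := IH1 d1 d1'; have [? e2] := IH2 d2 d2'; split=> //.
  by rewrite regroupD e1 e2 add_block_mx addr0 delta_sumD.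
- move=> p t q R1 IH1 R2 IH2 [d1 d2] [d1' d2'].
  have [? e1] := IH1 d1 d1'; have [? e2] := IH2 d2 d2'; split=> //.
  rewrite regroup_mul e1 e2 mulmx_block delta_sumM.
  by rewrite !mulmx0 !mul0mx !addr0 add0r.
- move=> p R IH [dR uR] [dR' uR']; have [dW eW] := IH dR dR'.
  (* Both diagonal blocks are invertible by the domain hypotheses, hence so is the whole value. *)
  have [uW ->] := regroup_inv uR uR' eW.
  by rewrite delta_sumV.
- move=> p2 q2 p1 q1 B IH dB dB'; split=> [a b|].
    by have [] := IH a b (dB a b) (dB' a b).
  (* The lower left zero, with inner blocks of size [n'] by [n], is written as a flattened family of
     zeros to fit the block rule. *)
  rewrite delta_sum_block -(flatten_blocks0 K p2 q2 p1 q1 n' n).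
  apply: regroup_flatten_blocks=> a b.
  by have [_ ->] := IH a b (dB a b) (dB' a b).
Qed.

End Bidiagonal.

Theorem theorem4p8 (K : fieldType) (d p q : nat) (R : ncexpr K d p q)
    (hR : is_ncrat R) (n n' : nat) (Z : mxtuple K d n) (Z' : mxtuple K d n')
    (hZ : in_dom R Z) (hZ' : in_dom R Z') (W : 'I_d -> 'M[K]_(n, n')) :
  let ZWZ' : mxtuple K d (n + n') :=
    fun j => block_mx (Z j) (W j) 0 (Z' j) in
  in_dom R ZWZ' /\
  castmx (mulnDl n n' p, mulnDl n n' q)
    (Pmx K (n + n') p *m nceval R ZWZ' *m (Pmx K (n + n') q)^T) =
  block_mx
    (Pmx K n p *m nceval R Z *m (Pmx K n q)^T)
    (Pmx K n p *m (\sum_(j < d) apply2 (nceval2 (Delta j R) Z Z') (W j))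
       *m (Pmx K n' q)^T)
    0
    (Pmx K n' p *m nceval R Z' *m (Pmx K n' q)^T).
Proof.
case: hZ hZ' => n_gt0 dZ [_ dZ'] ZWZ'.
have [dW eW] := nceval_bidiag W dZ dZ'.
split; last exact: Pmx_conj_regroup eW.
by split=> //; rewrite addn_gt0 n_gt0.
Qed.
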